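(* The algorithm DisProdTV described in the context is correct: for every input $n$ pairs $(P_i,Q_i)_{i=1}^n$ of probability distributions on $[M]=\{1,\dots,M\}$ and every rational $\epsilon\in(0,1)$, its output $Z$ satisfies $(1-\epsilon)d_{TV}(P,Q)\le Z\le(1+\epsilon)d_{TV}(P,Q)$, where $P=P_1\times\cdots\times P_n$ and $Q=Q_1\times\cdots\times Q_n$.
   Context: For probability distributions $P',Q'$ on a finite set, the ratio $P'\|Q'$ is the random variable $x\mapsto P'(x)/Q'(x)$ on the probability space (that finite set with law $Q'$) (defined $Q'$-almost surely). A valid ratio on a probability space $(\Omega,\mathcal{F},Q)$ is a non-negative random variable $R$ with $\mathbb{E}[R]\le 1$; for valid ratios $R_1$ on $(\Omega_1,\mathcal{F}_1,Q_1)$ and $R_2$ on $(\Omega_2,\mathcal{F}_2,Q_2)$ the independent product $R_1\circ R_2$ is the valid ratio $(\omega_1,\omega_2)\mapsto R_1(\omega_1)R_2(\omega_2)$ on $(\Omega_1\times\Omega_2,\mathcal{F}_1\times\mathcal{F}_2,Q_1\times Q_2)$. $TV(R)\defeq\mathbb{E}[(1-R)_+]$ with $x_+=\max\{x,0\}$. $(\gamma,\delta)$-partition, for $\gamma,\delta\in(0,1)$: $m=1+\lceil\ln(1/\gamma)/\ln(1+\delta)\rceil$, $a_0=1$, $a_m=0$, $a_k=1-(1+\delta)^{k-1}\gamma$ ($1\le k<m$); $I_0=\{1\}$, $I_k=[a_k,a_{k-1})$ ($1\le k\le m$), $J_k=(1/a_{k-1},1/a_k]$ ($1\le k<m$), $J_m=(1/a_{m-1},\infty)$;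 $\mathcal{I}_{\gamma,\delta}(x)$ is the interval among these containing $x\ge0$. The $(\gamma,\delta)$-discretization of a valid ratio $R$ is $\mathbb{E}[R\mid\sigma(\mathcal{I}_{\gamma,\delta}(R))]$. Algorithm DisProdTV: set $\Delta=\max_i d_{TV}(P_i,Q_i)$, $\gamma=\epsilon\Delta/(2n)$, $\delta=\epsilon/(2n)$; set $R_i=P_i\|Q_i$ and $Y_1=R_1$; for $i=1,\dots,n$: let $\tilde Y_i$ be the $(\gamma,\delta)$-discretization of $Y_i$, and if $i<n$ set $Y_{i+1}=\tilde Y_i\circ R_{i+1}$; return $Z=TV(\tilde Y_n)$. (Here $d_{TV}(P,Q)=\sup_A|P(A)-Q(A)|$.) *)

(* Defs.v *)
From mathcomp Require Import all_boot all_order all_algebra.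
From mathcomp Require Import mathcomp_extra boolp classical_sets reals exp.

Set Implicit Arguments.
Unset Strict Implicit.
Unset Printing Implicit Defensive.

Import Order.TTheory GRing.Theory Num.Theory.
Local Open Scope ring_scope.

Record fdist (R : realType) (T : finType) := FDist {
  pmf :> T -> R;
  pmf_ge0 : forall x, 0 <= pmf x;
  pmf_sum1 : \sum_x pmf x = 1 }.

Definition Pr (R : realType) (T : finType) (d : fdist R T) (A : {set T}) : R :=
  \sum_(x in A) d x.

Definition expect (R : realType) (T : finType) (d : fdist R T) (X : T -> R) : R :=
  \sum_x d x * X x.

Definition dTV (R : realType) (T : finType) (P Q : fdist R T) : R :=
  sup (range (fun A : {set T} => `|Pr P A - Pr Q A|)).

Section Products.
Variable R : realType.

Lemma prod2_ge0 (T U : finType) (p : fdist R T) (q : fdist R U) (x : T * U) :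
  0 <= p x.1 * q x.2.
Proof. by rewrite mulr_ge0 ?pmf_ge0. Qed.

Lemma prod2_sum1 (T U : finType) (p : fdist R T) (q : fdist R U) :
  \sum_(x : T * U) p x.1 * q x.2 = 1.
Proof.
rewrite -(pair_bigA _ (fun i j => p i * q j)) /=.
under eq_bigr do rewrite -mulr_sumr pmf_sum1 mulr1.
exact: pmf_sum1.
Qed.

Definition prod2 (T U : finType) (p : fdist R T) (q : fdist R U) :
  fdist R (T * U)%type := FDist (prod2_ge0 p q) (prod2_sum1 p q).

Lemma prodn_ge0 (I T : finType) (p : I -> fdist R T) (x : {ffun I -> T}) :
  0 <= \prod_i p i (x i).
Proof. by apply: prodr_ge0 => i _; exact: pmf_ge0. Qed.

Lemma prodn_sum1 (I T : finType) (p : I -> fdist R T) :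
  \sum_(x : {ffun I -> T}) \prod_i p i (x i) = 1.
Proof.
rewrite -(bigA_distr_bigA (fun i j => p i j)).
by rewrite big1 // => i _; exact: pmf_sum1.
Qed.

Definition prodn (I T : finType) (p : I -> fdist R T) :
  fdist R {ffun I -> T} := FDist (prodn_ge0 p) (prodn_sum1 p).

End Products.

(* E[X | sigma(G)] for a random variable G with values in an eqType; the value
   on a null fibre of G is irrelevant (it is 0 since 0^-1 = 0).  The lemmas
   cond_exp_meas and cond_exp_int are the two defining properties. *)
Definition cond_exp (R : realType) (T : finType) (K : eqType) (d : fdist R T)
    (G : T -> K) (X : T -> R) (w : T) : R :=
  (\sum_(v | G v == G w) d v * X v) / (\sum_(v | G v == G w) d v).

Section CondExp.
Variables (R : realType) (T : finType) (K : eqType) (d : fdist R T).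
Variables (G : T -> K) (X : T -> R).

Lemma cond_exp_meas (w w' : T) :
  G w = G w' -> cond_exp d G X w = cond_exp d G X w'.
Proof. by rewrite /cond_exp => ->. Qed.

Lemma cond_exp_int (B : pred K) :
  \sum_(w | B (G w)) d w * cond_exp d G X w = \sum_(w | B (G w)) d w * X w.
Proof.
under eq_bigr => w _ do rewrite /cond_exp mulrC -mulrA mulr_suml.
rewrite (exchange_big_dep (fun v => B (G v))) /=; last first.
  by move=> w v Bw /eqP ->.
apply: eq_bigr => v Bv.
rewrite (eq_bigl (fun w => G w == G v)); last first.
  by move=> w; rewrite eq_sym; case: eqP => [->|]; rewrite ?Bv ?andbF.
under eq_bigr => w /eqP -> do idtac.
rewrite -mulr_sumr -mulr_sumr.
set s := \sum_(i | _) d i.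
have [s0|s0] := eqVneq s 0; last by rewrite mulVf ?mulr1.
have := s0; move/eqP; rewrite psumr_eq0 => [|w _]; last exact: pmf_ge0.
move/allP => /(_ v (mem_index_enum v)); rewrite eqxx /= => /eqP ->.
by rewrite !mul0r.
Qed.

Lemma cond_exp_ge0 : (forall w, 0 <= X w) -> forall w, 0 <= cond_exp d G X w.
Proof.
move=> X0 w; apply: divr_ge0; apply: sumr_ge0 => v _; rewrite ?mulr_ge0 ?pmf_ge0 //.
Qed.

Lemma expect_cond_exp : expect d (cond_exp d G X) = expect d X.
Proof. exact: (cond_exp_int predT). Qed.

End CondExp.

(* A valid ratio together with the (finite) probability space carrying it. *)
Record vratio (R : realType) := VRatio {
  space : finType;
  law : fdist R space;
  rv :> space -> R;
  rv_ge0 : forall w, 0 <= rv w;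
  rv_mean : expect law rv <= 1 }.

Definition TV (R : realType) (X : vratio R) : R :=
  expect (law X) (fun w => Num.max (1 - X w) 0).

Section Ratios.
Variable R : realType.

Lemma ratio_ge0 (T : finType) (P Q : fdist R T) (x : T) : 0 <= P x / Q x.
Proof. by rewrite divr_ge0 ?pmf_ge0. Qed.

Lemma ratio_mean (T : finType) (P Q : fdist R T) :
  expect Q (fun x => P x / Q x) <= 1.
Proof.
rewrite -(pmf_sum1 P); apply: ler_sum => x _.
have [->|Qx] := eqVneq (Q x) 0; first by rewrite mul0r pmf_ge0.
by rewrite mulrC divfK.
Qed.

(* P || Q; at the Q-null points the quotient takes the irrelevant value 0. *)
Definition ratio (T : finType) (P Q : fdist R T) : vratio R :=
  VRatio (ratio_ge0 P Q) (ratio_mean P Q).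

Lemma indep_ge0 (X Y : vratio R) (w : space X * space Y) : 0 <= X w.1 * Y w.2.
Proof. by rewrite mulr_ge0 ?rv_ge0. Qed.

Lemma indep_mean (X Y : vratio R) :
  expect (prod2 (law X) (law Y)) (fun w => X w.1 * Y w.2) <= 1.
Proof.
rewrite /expect /=.
rewrite -(pair_bigA _ (fun i j => law X i * law Y j * (X i * Y j))) /=.
under eq_bigr do (under eq_bigr do rewrite mulrACA; rewrite -mulr_sumr).
rewrite -mulr_suml mulr_ile1 ?rv_mean //; apply: sumr_ge0 => w _;
  by rewrite mulr_ge0 ?rv_ge0 ?pmf_ge0.
Qed.

Definition indep_prod (X Y : vratio R) : vratio R :=
  VRatio (@indep_ge0 X Y) (indep_mean X Y).

End Ratios.

Section Partition.
Variables (R : realType) (gamma delta : R).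

(* For gamma, delta in (0, 1) the ceiling is positive, so that the absolute
   value only serves as a cast to nat. *)
Definition part_m : nat :=
  (1 + `|Num.ceil (ln (1 / gamma) / ln (1 + delta))|)%N.

Definition part_a (k : nat) : R :=
  if k == 0%N then 1
  else if k == part_m then 0
  else 1 - (1 + delta) ^+ k.-1 * gamma.

Definition part_I (k : nat) : interval R :=
  if k == 0%N then `[1, 1] else `[part_a k, part_a k.-1[.

Definition part_J (k : nat) : interval R :=
  if k == part_m then `](1 / part_a k.-1), +oo[
  else `](1 / part_a k.-1), (1 / part_a k)].

Definition partition_itvs : seq (interval R) :=
  [seq part_I k | k <- iota 0 part_m.+1] ++ [seq part_J k | k <- iota 1 part_m].

(* For gamma, delta in (0, 1) the intervals partition [0, +oo[, so that `the first
   interval containing x' is the only one; the default is never reached when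
   0 <= x. *)
Definition cell (x : R) : interval R :=
  nth `]-oo, +oo[ partition_itvs (find (fun I => x \in I) partition_itvs).

Definition discr_rv (X : vratio R) : space X -> R :=
  cond_exp (law X) (fun w => cell (X w)) X.

Lemma discr_ge0 (X : vratio R) (w : space X) : 0 <= discr_rv w.
Proof. exact/cond_exp_ge0/rv_ge0. Qed.

Lemma discr_mean (X : vratio R) : expect (law X) (@discr_rv X) <= 1.
Proof. rewrite expect_cond_exp; exact: rv_mean. Qed.

Definition discretization (X : vratio R) : vratio R :=
  VRatio (@discr_ge0 X) (discr_mean X).

End Partition.

Section Algorithm.
(* The input consists of n.+1 pairs, indexed from 0. *)
Variables (R : realType) (n M : nat) (P Q : 'I_n.+1 -> fdist R 'I_M) (eps : R).

Definition alg_Delta : R := \big[Num.max/0]_i dTV (P i) (Q i).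
Definition alg_gamma : R := eps * alg_Delta / (2 * n.+1%:R).
Definition alg_delta : R := eps / (2 * n.+1%:R).
Definition alg_R (i : 'I_n.+1) : vratio R := ratio (P i) (Q i).

Fixpoint alg_Y (i : nat) : vratio R :=
  if i is j.+1 then
    indep_prod (discretization alg_gamma alg_delta (alg_Y j)) (alg_R (inord j.+1))
  else alg_R ord0.

(* If all P i = Q i then alg_gamma = 0, outside the range (0, 1) for which the
   partition is meant; the total operations of the library then give part_m = 1
   and the intervals {1}, [0, 1[, ]1, +oo[. *)
Definition DisProdTV : R := TV (discretization alg_gamma alg_delta (alg_Y n)).

End Algorithm.

(* Main.v *)
Require Import Defs.
From mathcomp Require Import all_boot all_order all_algebra.
From mathcomp Require Import mathcomp_extra boolp classical_sets reals exp.
From mathcomp Require Import lra ring.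

Import Order.TTheory GRing.Theory Num.Theory.
Local Open Scope ring_scope.

(* Write hinge S x = E (1 - x S)_+, so that TV (X o S) = E (hinge S X).  The
   function hinge S is convex, and a discretization is a conditional expectation,
   so by Jensen discretizing never increases TV (X o S).  Conversely, let r be the
   mean of X over a cell.  Up to a term linear in x - r, which vanishes in
   conditional mean, hinge S x - hinge S r is at most |x - r| / (2 max (1, r)):
   for r <= 1 because hinge S is 1-Lipschitz, for r > 1 by convexity on [0, r].
   The partition is designed so that this is at most
   (gamma max (1, x) + delta |1 - x|) / 2, whose mean is at most
   gamma + delta TV X.  Since TV X <= TV (X o S), replacing the Y_i one after the
   other by their discretizations, while keeping the remaining factors exact, loses
   at most n (gamma + delta dTV (P, Q)) <= eps dTV (P, Q). *)

(** * Expectations and conditional expectations on finite spaces *)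

Section Expectation.
Context {R : realType} {T : finType} (d : fdist R T).
Implicit Types f g : T -> R.

(** Only points of positive mass are tested: on a null cell a conditional expectation takes the
    default value 0, and distance bounds may fail there. *)
Lemma expect_le f g : (forall w, 0 < d w -> f w <= g w) ->
  expect d f <= expect d g.
Proof.
move=> fg; apply: ler_sum => w _.
have := pmf_ge0 d w; rewrite le_eqVlt => /orP[/eqP <-|dw].
  by rewrite !mul0r.
by rewrite ler_pM2l // fg.
Qed.

Lemma eq_expect {f g} : f =1 g -> expect d f = expect d g.
Proof. by move=> fg; apply: eq_bigr => w _; rewrite fg. Qed.

Lemma expectD f g : expect d (fun w => f w + g w) = expect d f + expect d g.
Proof. by rewrite -big_split; apply: eq_bigr => w _; rewrite mulrDr. Qed.

Lemma expectZ (c : R) f : expect d (fun w => c * f w) = c * expect d f.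
Proof. by rewrite mulr_sumr; apply: eq_bigr => w _; rewrite mulrCA. Qed.

Lemma expect_cst (c : R) : expect d (fun=> c) = c.
Proof. by rewrite /expect -mulr_suml pmf_sum1 mul1r. Qed.

Lemma expect_ge0 f : (forall w, 0 <= f w) -> 0 <= expect d f.
Proof. by move=> f0; rewrite -(expect_cst 0); apply: expect_le. Qed.

End Expectation.

Lemma expect_prod2 {R : realType} {T U : finType} (p : fdist R T) (q : fdist R U)
    (f : T * U -> R) :
  expect (prod2 p q) f = expect p (fun x => expect q (fun y => f (x, y))).
Proof.
rewrite /expect (eq_bigr (fun x => p x.1 * q x.2 * f (x.1, x.2))) /=; last first.
  by move=> [].
rewrite -(pair_bigA _ (fun x y => p x * q y * f (x, y))) /=.
by apply: eq_bigr => x _; rewrite mulr_sumr; apply: eq_bigr => y _; rewrite mulrA.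
Qed.

Section CondExpTheory.
Context {R : realType} {T : finType} {K : eqType} (d : fdist R T).
Variables (G : T -> K) (X : T -> R).

Lemma cond_exp_pull (h : T -> R) :
  (forall v w, G v = G w -> h v = h w) ->
  expect d (fun w => h w * cond_exp d G X w) = expect d (fun w => h w * X w).
Proof.
move=> hG; rewrite -[RHS](@expect_cond_exp _ _ _ _ G); apply: eq_expect => w.
rewrite /cond_exp mulrA mulr_sumr; congr (_ / _).
by apply: eq_bigr => v /eqP vw; rewrite (hG v w) // mulrCA.
Qed.

(** A conditional expectation is a weighted mean over the fibre of [w], so the triangle inequality
    averages a bound affine in [X v]; [0 < d w] makes the mass of the fibre invertible. *)
Lemma cond_exp_dist (a b : R) (w : T) : 0 < d w ->
  (forall v, G v = G w -> `|X w - X v| <= a + b * X v) ->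
  `|X w - cond_exp d G X w| <= a + b * cond_exp d G X w.
Proof.
move=> dw ab; rewrite /cond_exp.
set s := \sum_(v | _) d v; set t := \sum_(v | _) _.
have s_gt0 : 0 < s.
  rewrite /s (bigD1 w) //= ltr_pwDl //; apply: sumr_ge0 => v _; exact: pmf_ge0.
have sN0 : s != 0 by rewrite gt_eqF.
rewrite -(ler_pM2l s_gt0) -{1}(gtr0_norm s_gt0) -normrM.
rewrite mulrBr mulrDr (mulrCA s b) !(mulrCA s t) !mulfV // mulr1.
rewrite /s /t !mulr_suml mulr_sumr -sumrB -big_split /=.
apply: le_trans (ler_norm_sum _ _ _) _; apply: ler_sum => v /eqP vw.
rewrite -mulrBr normrM ger0_norm ?pmf_ge0 //.
by rewrite mulrCA -mulrDr ler_wpM2l ?pmf_ge0 // ab.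
Qed.

End CondExpTheory.

(** * Hinge functions: supporting lines and upper bounds *)

Section Hinge.
Context {R : realType}.
Implicit Types (X Y S : vratio R) (x r : R).

Definition hinge S x : R := expect (law S) (fun w => Num.max (1 - x * S w) 0).

Lemma TV_ge0 X : 0 <= TV X.
Proof. by apply: expect_ge0 => w; rewrite le_max lexx orbT. Qed.

Lemma TV_indep_prod X S :
  TV (indep_prod X S) = expect (law X) (fun w => hinge S (X w)).
Proof. exact: expect_prod2. Qed.

Lemma TV_indep_prodC X Y : TV (indep_prod X Y) = TV (indep_prod Y X).
Proof.
rewrite !TV_indep_prod /hinge /expect.
under eq_bigr do rewrite mulr_sumr.
rewrite exchange_big /=; apply: eq_bigr => w _.
rewrite mulr_sumr; apply: eq_bigr => v _.
by rewrite mulrCA (mulrC (X v)).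
Qed.

Lemma TV_indep_prodA X Y S :
  TV (indep_prod X (indep_prod Y S)) = TV (indep_prod (indep_prod X Y) S).
Proof.
rewrite !TV_indep_prod expect_prod2; apply: eq_expect => w.
rewrite [LHS]expect_prod2; apply: eq_expect => v; apply: eq_expect => u /=.
by rewrite mulrA.
Qed.

Lemma hinge_ge0 S x : 0 <= hinge S x.
Proof. by apply: expect_ge0 => w; rewrite le_max lexx orbT. Qed.

(** A subgradient of [hinge S] at [r]: the mean slope of the integrand, taken to be 0 at its
    kink. *)
Definition hinge_slope S r : R :=
  - expect (law S) (fun w => if r * S w < 1 then S w else 0).

(** Pointwise, the tangent at [r] is one of the two lines [1 - x * S w] and [0], whose maximum is
    the integrand. *)
Lemma hinge_support S x r :
  hinge S r + hinge_slope S r * (x - r) <= hinge S x.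
Proof.
rewrite /hinge_slope mulNr -mulrN mulrC -expectZ -expectD; apply: expect_le => w _.
by case: (leP (1 - x * S w) 0); case: (ltP (r * S w) 1);
  case: (leP (1 - r * S w) 0); nra.
Qed.

(** Jensen in [S]: since [S] has mean at most 1, [hinge S x] is at least [1 - x] for [0 <= x], and
    it is non-negative. *)
Lemma TV_le_indep_prod X S : TV X <= TV (indep_prod X S).
Proof.
rewrite TV_indep_prod; apply: expect_le => w _.
rewrite ge_max hinge_ge0 andbT.
have -> : 1 - X w = 1 + - X w * 1 by ring.
have Xw := rv_ge0 w.
apply: (@le_trans _ _ (1 + - X w * expect (law S) S)).
  by rewrite lerD2l ler_wnM2l ?oppr_le0 // rv_mean.
rewrite -(expect_cst (law S) 1) -expectZ -expectD; apply: expect_le => v _.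
by rewrite mulNr le_max lexx.
Qed.

Lemma hinge_lipschitz S x r :
  hinge S x <= hinge S r + Num.max (r - x) 0.
Proof.
apply: (@le_trans _ _ (hinge S r + Num.max (r - x) 0 * expect (law S) S)).
  rewrite -expectZ -expectD; apply: expect_le => w _.
  have := rv_ge0 w.
  by case: (leP (1 - x * S w) 0); case: (leP (r - x) 0);
    case: (leP (1 - r * S w) 0); nra.
have := rv_mean S; have : 0 <= Num.max (r - x) 0 by rewrite le_max lexx orbT.
by nra.
Qed.

(* Convexity along [0, r], using hinge S 0 = 1. *)
Lemma hinge_chord S x r : 0 <= x -> 0 < r ->
  hinge S x <= x / r * hinge S r + Num.max (1 - x / r) 0.
Proof.
move=> x0 r0; rewrite -[X in _ + X](expect_cst (law S)) -expectZ -expectD.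
apply: expect_le => w _; have s0 := rv_ge0 w.
have t0 : 0 <= x / r by rewrite divr_ge0 // ltW.
have {1}-> : x = x / r * r by rewrite divfK // gt_eqF.
(* With [t = x / r] and [u = r * S w], take positive parts in
   [1 - t * u = t * (1 - u) + (1 - t)]. *)
move: (x / r) t0 => t t0; have rs : 0 <= r * S w by rewrite mulr_ge0 // ltW.
rewrite -mulrA; move: (r * S w) rs => u u0.
by case: (leP (1 - t * u) 0); case: (leP (1 - t) 0); case: (leP (1 - u) 0); nra.
Qed.

Lemma hinge_upper S r : 0 <= r -> exists l : R, forall x, 0 <= x ->
  hinge S x <= hinge S r + l * (x - r) + 2^-1 * (`|x - r| / Num.max 1 r).
Proof.
move=> r0; have [r1|r1] := leP r 1.
  (* This slope comes from [(r - x)_+ = |x - r| / 2 - (x - r) / 2]. *)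
  exists (- 2^-1) => x x0; have := hinge_lipschitz S x r.
  rewrite divr1; have [|] := leP (r - x) 0; have [|] := ler0P (x - r); lra.
have rgt0 : 0 < r by lra.
have rN0 : r != 0 by rewrite gt_eqF.
(* The chord contributes [hinge S r / r], the linear half of [(1 - x / r)_+] contributes
   [- 2^-1 / r]. *)
exists (hinge S r / r - 2^-1 / r) => x x0.
have := hinge_chord S x r x0 rgt0.
suff -> : Num.max (1 - x / r) 0 = 2^-1 * (`|x - r| / r) + 2^-1 * (1 - x / r).
  move/le_trans; apply; rewrite le_eqVlt; apply/orP; left; apply/eqP.
  by move: `|x - r| (hinge S r) => a b; field.
have -> : `|x - r| / r = `|1 - x / r|.
  by rewrite -{2}(gtr0_norm rgt0) -normf_div mulrBl mulfV // distrC.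
by move: (x / r) => t; have [|] := leP (1 - t) 0; have [|] := ler0P (1 - t); lra.
Qed.

End Hinge.

(** * The partition: covering and width of the cells *)

Section PartitionTheory.
Context {R : realType} (g d : R).
Hypotheses (g0 : 0 < g) (g1 : g < 1) (d0 : 0 < d).
Let m := part_m g d.
Let a := part_a g d.

(** Taking logarithms, the ceiling [m'.+1] is the first exponent at which [(1 + d) ^+ k * g] reaches
    1. So [a] is positive before [m], and its geometric formula would be at most 0 at [m]. *)
Lemma part_m_bounds : exists2 m', m = m'.+2 &
  (1 + d) ^+ m' * g < 1 <= (1 + d) ^+ m'.+1 * g.
Proof.
have ln_gt : 0 < ln (1 + d) by rewrite ln_gt0 // ltrDl.
have gV1 : 1 < 1 / g by rewrite ltr_pdivlMr // mul1r.
have L0 : 0 < ln (1 / g) / ln (1 + d) by rewrite divr_gt0 // ln_gt0.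
have c0 : 0 < Num.ceil (ln (1 / g) / ln (1 + d)) by rewrite ceil_gt0.
have := ceil_itv (ln (1 / g) / ln (1 + d)).
rewrite /m /part_m; case: (Num.ceil _) c0 => // -[//|k] _ /andP[lo hi].
exists k => //.
have dk_gt0 j : 0 < (1 + d) ^+ j by rewrite exprn_gt0 // addr_gt0.
have -> : (1 + d) ^+ k * g < 1 by
  rewrite -ltr_pdivlMr // -ltr_ln ?posrE ?divr_gt0 // lnXn ?addr_gt0 //
    -mulr_natl -ltr_pdivlMr // (le_lt_trans _ lo) // -addn1 PoszD addrK.
rewrite -ler_pdivrMr // -ler_ln ?posrE ?divr_gt0 // lnXn ?addr_gt0 //.
by rewrite -mulr_natl -ler_pdivrMr.
Qed.

Lemma part_a_lt1 k : (0 < k)%N -> a k < 1.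
Proof.
case: k => // k _; rewrite /a /part_a /=; case: ifP => // _.
by rewrite gtrBl mulr_gt0 // exprn_gt0 // addr_gt0.
Qed.

Lemma part_a_le1 k : a k <= 1.
Proof. by case: k => [|k]; [rewrite /a /part_a | apply/ltW/part_a_lt1]. Qed.

Lemma part_a_gt0 k : (k < m)%N -> 0 < a k.
Proof.
case: k => [|k] km; rewrite /a /part_a //= ltn_eqF // subr_gt0.
have [m' Em /andP[lt1 _]] := part_m_bounds.
apply: le_lt_trans lt1; rewrite ler_pM2r // ler_weXn2l //; first by rewrite lerDl ltW.
by rewrite Em !ltnS in km.
Qed.

Lemma part_am : a m = 0.
Proof. by rewrite /a /part_a eqxx; case: eqP. Qed.

(** The first cell has width [g]. As [1 - a k] grows by the factor [1 + d], each later cell has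
    width at most [d * (1 - a k.-1)], and [x < a k.-1]; truncating [a m] to 0 only shrinks the last
    cell. *)
Lemma part_a_width k x y : (0 < k <= m)%N ->
  a k <= x < a k.-1 -> a k <= y < a k.-1 -> `|x - y| <= g + d * (1 - x).
Proof.
move: (g0) (d0) => g_gt0 d_gt0 /andP[k0 km] /andP[x1 x2] /andP[y1 y2].
have [m' Em /andP[_ ge1]] := part_m_bounds.
have xy : `|x - y| <= a k.-1 - a k by case: ler0P; lra.
have xle1 := lt_le_trans x2 (part_a_le1 k.-1).
apply: le_trans xy _; case: k => [//|[|k]] in k0 km x1 x2 y1 y2 *.
  by rewrite /a /part_a -/m Em /=; nra.
have kNm : k.+1 == m = false by rewrite ltn_eqF.
suff: a k.+1 - a k.+2 <= d * (1 - a k.+1) by rewrite /= in x2 *; nra.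
rewrite /a /part_a -/m /= kNm; case: eqP => [Ek|_]; last first.
  by rewrite exprS le_eqVlt; apply/orP; left; apply/eqP; ring.
have Ekm : k = m' by apply: succn_inj; apply: succn_inj; rewrite Ek.
by rewrite Ekm; rewrite exprS in ge1; lra.
Qed.

(** The least [k] with [a k <= x] works: it exists because [a m = 0], and minimality gives
    [x < a k.-1]. *)
Lemma part_a_cover x : 0 <= x < 1 ->
  exists2 k, (0 < k <= m)%N & a k <= x < a k.-1.
Proof.
move=> /andP[x0 x1].
have ex : exists k, a k <= x by exists m; rewrite part_am.
case: (ex_minnP ex) => -[|k] akx kmin.
  by move: akx; rewrite /a /part_a leNgt x1.
exists k.+1; first by rewrite kmin ?part_am.
by rewrite akx /= ltNge; apply/negP => /kmin; rewrite ltnn.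
Qed.

(** Ensures that the search in [cell] succeeds. Above 1, inversion carries the question back to [[0,
    1[]. *)
Lemma part_itv_cover x : 0 <= x -> has (fun I => x \in I) (partition_itvs g d).
Proof.
move=> x0; rewrite has_cat; have [x1|x1|->] := ltgtP x 1; last first.
- by apply/orP; left; rewrite /= in_itv /= lexx.
- apply/orP; right.
  have xgt0 : 0 < x by lra.
  have xV : 0 <= x^-1 < 1 by rewrite invr_ge0 x0 invf_lt1.
  have [k /andP[k0 km] /andP[akx xak]] := part_a_cover x^-1 xV.
  apply/hasP; exists (part_J g d k).
    by apply: map_f; rewrite mem_iota k0 add1n ltnS.
  have ak1 : 0 < a k.-1 by apply: part_a_gt0; rewrite prednK.
  have xgt : 1 / a k.-1 < x by rewrite div1r invf_plt ?posrE.
  rewrite /part_J; case: eqP => [_|/eqP kNm]; rewrite in_itv /= ?andbT xgt //=.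
  rewrite div1r -[x]invrK lef_pV2 ?posrE ?invr_gt0 // part_a_gt0 //.
  by rewrite ltn_neqAle kNm.
- apply/orP; left.
  have xI : 0 <= x < 1 by rewrite x0 x1.
  have [k /andP[k0 km] akx] := part_a_cover x xI.
  apply/hasP; exists (part_I g d k); first by apply: map_f; rewrite mem_iota add0n ltnS.
  by rewrite /part_I gtn_eqF // in_itv.
Qed.

Lemma mem_cell x : 0 <= x -> x \in cell g d x.
Proof. by move=> x0; apply: (nth_find _ (part_itv_cover x x0)). Qed.

Lemma cell_partition x : 0 <= x -> cell g d x \in partition_itvs g d.
Proof. by move=> x0; apply: mem_nth; rewrite -has_find part_itv_cover. Qed.

(* Above 1 it is the inverses that are close, hence the factor y. *)
Lemma cell_dist x y : 0 <= x -> 0 <= y -> cell g d x = cell g d y ->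
  `|x - y| <= (if x <= 1 then 1 else y) * (g * Num.max 1 x + d * `|1 - x|).
Proof.
move=> x0 y0 exy; have := mem_cell x x0; have := mem_cell y y0.
have := cell_partition x x0; rewrite -{}exy mem_cat.
case/orP => /mapP[k]; rewrite mem_iota => /andP[kge klt] ->.
  rewrite /part_I; case: eqP => [_|/eqP k0].
    rewrite !in_itv /= => yI xI; have [-> ->] : x = 1 /\ y = 1 by lra.
    by rewrite !subrr !normr0 mulr0 addr0 lexx mul1r maxxx mulr1 ltW.
  rewrite !in_itv /= => yI xI.
  have kI : (0 < k <= m)%N by rewrite lt0n k0.
  have xlt1 : x < 1 by case/andP: xI => _ /lt_le_trans; apply; exact: part_a_le1.
  rewrite (ltW xlt1) mul1r (max_idPl (ltW xlt1)) mulr1.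
  rewrite (ger0_norm (x := 1 - x)); last by lra.
  exact: part_a_width k x y kI xI yI.
have kI : (0 < k <= m)%N by rewrite kge -ltnS.
have ak1 : 0 < a k.-1 by apply: part_a_gt0; rewrite prednK // -ltnS.
have J z : 0 <= z -> z \in part_J g d k -> 1 < z /\ a k <= z^-1 < a k.-1.
  move=> z0 zJ.
  have zgt : 1 / a k.-1 < z.
    by move: zJ; rewrite /part_J; case: ifP => _; rewrite in_itv /= => /andP[].
  have z1 : 1 < z.
    by apply: le_lt_trans zgt; rewrite div1r invf_ge1 // part_a_le1.
  have zgt0 : 0 < z by lra.
  have -> : z^-1 < a k.-1 by move: zgt; rewrite div1r invf_plt.
  split=> //; rewrite andbT.
  move: zJ; rewrite /part_J; case: eqP => [->|/eqP kNm].
    by rewrite part_am invr_ge0 z0.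
  rewrite in_itv /= => /andP[_]; rewrite div1r => zle.
  have ak : 0 < a k by apply: part_a_gt0; rewrite ltn_neqAle kNm; case/andP: kI.
  by rewrite -[a k]invrK lef_pV2 ?posrE ?invr_gt0.
move=> /(J y y0)[y1 yI] /(J x x0)[x1 xI].
have := part_a_width k x^-1 y^-1 kI xI yI.
have xgt0 : 0 < x by lra.
have ygt0 : 0 < y by lra.
rewrite (leNgt x 1) x1 /= (max_idPr (ltW x1)) (distrC 1 x).
rewrite (gtr0_norm (x := x - 1)) ?subr_gt0 //.
(* The inverses share a cell below 1; multiplying their width bound by [x * y] produces the factor
   [y]. *)
have -> : x - y = x * y * (y^-1 - x^-1) by field; rewrite !gt_eqF.
rewrite normrM gtr0_norm ?mulr_gt0 // distrC => w.
have -> : y * (g * x + d * (x - 1)) = x * y * (g + d * (1 - x^-1)).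
  by field; rewrite gt_eqF.
by rewrite ler_pM2l // mulr_gt0.
Qed.

End PartitionTheory.

(** * Effect of one discretization on the total variation *)

Section Discretization.
Context {R : realType} (g d : R).
Implicit Types X S : vratio R.

Lemma discretization_TV_le X S :
  TV (indep_prod (discretization g d X) S) <= TV (indep_prod X S).
Proof.
rewrite !TV_indep_prod /=; set r := discr_rv (X := X) g d.
(* The supporting line at [r w] has a slope constant on cells, so its linear term has mean 0 by
   [cond_exp_pull]. *)
apply: (@le_trans _ _ (expect (law X) (fun w => hinge S (r w) +
    (hinge_slope S (r w) * X w + (- hinge_slope S (r w)) * r w)))).
  rewrite !expectD [X in _ + (_ + X)]cond_exp_pull; last first.
    by move=> v w vw; rewrite /r /discr_rv (cond_exp_meas _ _ vw).
  rewrite -expectD -[X in X <= _]addr0 lerD2l /=.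
  rewrite -(expect_cst (law X) 0); apply: expect_le => w _.
  by rewrite -mulrDl subrr mul0r.
apply: expect_le => w _.
have := hinge_support S (X w) (r w); move: (hinge_slope S (r w)) => l; lra.
Qed.

(** Averages [cell_dist] over the cell of [w]: the factor 1 stays, while the factor [X v] becomes
    the cell mean. *)
Lemma discretization_dist X w : 0 < g -> g < 1 -> 0 < d -> 0 < law X w ->
  `|X w - discr_rv (X := X) g d w| <=
  Num.max 1 (discr_rv (X := X) g d w) * (g * Num.max 1 (X w) + d * `|1 - X w|).
Proof.
move=> g0 g1 d0 lw; set c := g * _ + _.
have c0 : 0 <= c.
  apply: addr_ge0; apply: mulr_ge0 => //; rewrite ?(ltW g0) ?(ltW d0) //.
  by rewrite le_max ler01.
have close v : cell g d (X v) = cell g d (X w) ->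
    `|X w - X v| <= (if X w <= 1 then 1 else X v) * c.
  by move=> e; apply: cell_dist => //; exact: rv_ge0.
rewrite /discr_rv; have [x1|x1] := leP (X w) 1.
  apply: (@le_trans _ _ (c + 0 * discr_rv (X := X) g d w)).
    apply: cond_exp_dist => // v /close; rewrite x1 mul1r => h; lra.
  by rewrite mul0r addr0 ler_peMl // le_max lexx.
apply: (@le_trans _ _ (0 + c * discr_rv (X := X) g d w)).
  apply: cond_exp_dist => // v /close; rewrite (leNgt (X w) 1) x1 /= => h; lra.
by rewrite add0r mulrC ler_wpM2r // le_max lexx orbT.
Qed.

Lemma discretization_TV_ge X S : 0 < g -> g < 1 -> 0 < d ->
  TV (indep_prod X S) <=
  TV (indep_prod (discretization g d X) S) + (g + d * TV X).
Proof.
move=> g0 g1 d0; rewrite !TV_indep_prod /=.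
set r := discr_rv (X := X) g d.
have r0 w : 0 <= r w by exact: discr_ge0.
(* Choosing the slope as a function of the cell mean makes it constant on cells, as [cond_exp_pull]
   requires. *)
pose l x :=
  if pselect (0 <= x) is left x0 then projT1 (cid (hinge_upper S x x0)) else 0.
have lP x y : 0 <= x -> 0 <= y -> hinge S y <=
    hinge S x + l x * (y - x) + 2^-1 * (`|y - x| / Num.max 1 x).
  by move=> x0 y0; rewrite /l; case: pselect => // h; case: cid => /= z; apply.
pose c x := g * Num.max 1 x + d * `|1 - x|.
apply: (@le_trans _ _ (expect (law X) (fun w => hinge S (r w) +
    (l (r w) * X w + - l (r w) * r w) + 2^-1 * c (X w)))).
  apply: expect_le => w lw; have := lP (r w) (X w) (r0 w) (rv_ge0 w).
  rewrite mulrBr mulNr => /le_trans; apply; rewrite lerD2l ler_pM2l ?invr_gt0 //.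
  rewrite ler_pdivrMr ?lt_max ?ltr01 // mulrC.
  exact: discretization_dist.
rewrite !expectD [X in _ + (_ + X) + _]cond_exp_pull; last first.
  by move=> v w vw; rewrite /r /discr_rv (cond_exp_meas _ _ vw).
have -> : expect (law X) (fun w => - l (r w) * X w) =
    - expect (law X) (fun w => l (r w) * X w).
  by rewrite -mulN1r -expectZ; apply: eq_expect => w; rewrite mulN1r mulNr.
rewrite subrr addr0 lerD2l.
(* |1 - x| = 2 (1 - x)_+ + x - 1, and max (1, x) <= 1 + x. *)
apply: (@le_trans _ _ (expect (law X) (fun w =>
    2^-1 * (g - d) + 2^-1 * (g + d) * X w + d * Num.max (1 - X w) 0))).
  apply: expect_le => w _; have := rv_ge0 w; rewrite /c.
  by case: (leP (1 - X w) 0); case: (leP 1 (X w)); case: (ler0P (1 - X w)); nra.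
(* With [E X <= 1], the first two terms add up to at most [g]. *)
rewrite !expectD !expectZ expect_cst -/(TV X).
by have := rv_mean X; nra.
Qed.

End Discretization.

(** * Ratios and total variation distance, for single and product distributions *)

(** Both sides equal the sum of [(Q x - P x)_+]; the supremum is attained on the set where
    [P x < Q x]. *)
Lemma TV_ratio {R : realType} {T : finType} (P Q : fdist R T) :
  TV (Defs.ratio P Q) = dTV P Q.
Proof.
have TVE : TV (Defs.ratio P Q) = \sum_x Num.max (Q x - P x) 0.
  apply: eq_bigr => x _ /=; have [Qx|Qx] := eqVneq (Q x) 0.
    by rewrite Qx mul0r sub0r; apply/esym/max_idPr; rewrite oppr_le0 pmf_ge0.
  by rewrite maxr_pMr ?pmf_ge0 // mulr0 mulrBr mulr1 mulrCA mulfV // mulr1.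
have sum0 : \sum_x (P x - Q x) = 0 by rewrite sumrB !pmf_sum1 subrr.
have PrB A : Pr P A - Pr Q A = \sum_(x in A) (P x - Q x) by rewrite sumrB.
have bound : ubound (range (fun A : {set T} => `|Pr P A - Pr Q A|))
    (TV (Defs.ratio P Q)).
  move=> _ [A _ <-]; rewrite TVE PrB ler_norml; apply/andP; split.
    rewrite -sumrN big_mkcond [X in _ <= X]big_mkcond /=; apply: ler_sum => x _.
    by case: (x \in A); case: (leP (Q x - P x) 0); lra.
  (* Adding [P x - Q x], of total 0, turns [(Q x - P x)_+] into [(P x - Q x)_+]. *)
  apply: (@le_trans _ _ (\sum_x (Num.max (Q x - P x) 0 + (P x - Q x)))); last first.
    by rewrite big_split /= sum0 addr0.
  rewrite big_mkcond /=; apply: ler_sum => x _.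
  by case: (x \in A); case: (leP (Q x - P x) 0); lra.
apply/eqP; rewrite eq_le; apply/andP; split; last first.
  apply: ge_sup => //.
  by exists `|Pr P finset.set0 - Pr Q finset.set0|; exists finset.set0.
pose A : {set T} := [set x | P x < Q x]%SET.
apply: (@le_trans _ _ `|Pr P A - Pr Q A|); last first.
  apply: ub_le_sup; first by exists (TV (Defs.ratio P Q)).
  by exists A.
rewrite TVE PrB -normrN -sumrN; apply: le_trans (ler_norm _).
rewrite [X in _ <= X]big_mkcond /=; apply: ler_sum => x _.
by rewrite inE; case: (leP (Q x - P x) 0); case: (ltP (P x) (Q x)); lra.
Qed.

Section FfunCons.
Context {R : realType} {T : finType} {n : nat}.

Definition fcons (a : T) (y : {ffun 'I_n -> T}) : {ffun 'I_n.+1 -> T} :=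
  [ffun i => oapp y a (unlift ord0 i)].

Lemma fcons0 a y : fcons a y ord0 = a.
Proof. by rewrite ffunE unlift_none. Qed.

Lemma fconsS a y i : fcons a y (lift ord0 i) = y i.
Proof. by rewrite ffunE liftK. Qed.

Lemma expect_prodnS (Q : 'I_n.+1 -> fdist R T) (f : {ffun 'I_n.+1 -> T} -> R) :
  expect (prodn Q) f = expect (Q ord0) (fun a =>
    expect (prodn (fun i => Q (lift ord0 i))) (fun y => f (fcons a y))).
Proof.
rewrite -(expect_prod2 _ _ (fun z => f (fcons z.1 z.2))) /expect.
rewrite (reindex (fun z => fcons z.1 z.2)) /=.
  apply: eq_bigr => -[a y] _ /=; rewrite big_ord_recl fcons0.
  by congr (_ * _ * _); apply: eq_bigr => i _; rewrite fconsS.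
exists (fun x => (x ord0, [ffun i => x (lift ord0 i)])) => [[a y] _|x _].
  by rewrite /= fcons0; congr pair; apply/ffunP => i; rewrite ffunE fconsS.
apply/ffunP => i; have [j ->|->] := unliftP ord0 i.
  by rewrite fconsS /= ffunE.
by rewrite fcons0.
Qed.

End FfunCons.

Section RatioProducts.
Context {R : realType}.
Implicit Types X S : vratio R.

Lemma unit_sum1 : \sum_(x : unit) (1 : R) = 1.
Proof. by rewrite big_const card_unit /= addr0. Qed.

Definition unit_dist : fdist R unit := FDist (fun=> ler01) unit_sum1.

Definition one_ratio : vratio R := Defs.ratio unit_dist unit_dist.

(** A fold over a list, so that the factors still to be processed form a suffix of the
    enumeration. *)
Definition ratio_prod {I : Type} (F : I -> vratio R) (s : seq I) : vratio R :=
  foldr (fun i S => indep_prod (F i) S) one_ratio s.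

Lemma TV_indep_prod_one X : TV (indep_prod X one_ratio) = TV X.
Proof.
rewrite TV_indep_prod; apply: eq_expect => w.
rewrite -[RHS](expect_cst unit_dist); apply: eq_expect => v /=.
by rewrite divr1 mulr1.
Qed.

Lemma TV_le_ratio_prod {I : eqType} (F : I -> vratio R) (s : seq I) i :
  i \in s -> TV (F i) <= TV (ratio_prod F s).
Proof.
elim: s => //= j s IH; rewrite inE => /predU1P[->|/IH Fi].
  exact: TV_le_indep_prod.
by apply: le_trans Fi _; rewrite TV_indep_prodC TV_le_indep_prod.
Qed.

(** The nested pairs and the function space carry the same law of the product. A general [h] lets
    the induction absorb the first factor into it. *)
Lemma expect_ratio_prod {T : finType} n (P Q : 'I_n -> fdist R T) (h : R -> R) :
  let S := ratio_prod (fun i => Defs.ratio (P i) (Q i)) (enum 'I_n) in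
  expect (law S) (fun w => h (S w)) =
  expect (prodn Q) (fun x => h (\prod_i (P i (x i) / Q i (x i)))).
Proof.
elim: n P Q h => [|n IH] P Q h /=.
  rewrite enum_ord0 /= -[RHS](expect_cst unit_dist); apply: eq_expect => v /=.
  rewrite divr1 -[LHS](expect_cst (prodn Q)); apply: eq_expect => x.
  by rewrite big_ord0.
rewrite enum_ordSl /= /ratio_prod foldr_map expect_prod2 expect_prodnS.
apply: eq_expect => a /=.
rewrite (IH _ _ (fun x => h (P ord0 a / Q ord0 a * x))); apply: eq_expect => y.
rewrite big_ord_recl fcons0; congr (h (_ * _)).
by apply: eq_bigr => i _; rewrite fconsS.
Qed.

Lemma TV_ratio_prod {T : finType} n (P Q : 'I_n -> fdist R T) :
  TV (ratio_prod (fun i => Defs.ratio (P i) (Q i)) (enum 'I_n)) =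
  dTV (prodn P) (prodn Q).
Proof.
rewrite -TV_ratio /TV (expect_ratio_prod _ P Q (fun x => Num.max (1 - x) 0)).
by apply: eq_expect => x /=; rewrite prodf_div.
Qed.

End RatioProducts.

Lemma dTV_le1 {R : realType} {T : finType} (P Q : fdist R T) : dTV P Q <= 1.
Proof.
rewrite -TV_ratio -(expect_cst (law (Defs.ratio P Q)) 1); apply: expect_le => w _.
by rewrite ge_max ler01 gerBl rv_ge0.
Qed.

(** * Hybrid argument and error budget *)

Section Correctness.
Context {R : realType} {n M : nat} (P Q : 'I_n.+1 -> fdist R 'I_M) (eps : R).
Let g := alg_gamma P Q eps.
Let d := alg_delta n eps.
Let Y := alg_Y P Q eps.
Let D := dTV (prodn P) (prodn Q).

(** [Y i] already contains factor [i], counted from 0, and has undergone [i] discretizations; the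
    factors after [i] are exact. *)
Definition hybrid (i : nat) : R :=
  TV (indep_prod (Y i) (ratio_prod (alg_R P Q) (drop i.+1 (enum 'I_n.+1)))).

Lemma hybrid0 : hybrid 0 = D.
Proof.
rewrite /D -TV_ratio_prod /hybrid -/(alg_R P Q).
by rewrite [in RHS]enum_ordSl enum_ordSl /= drop0.
Qed.

(** By associativity, factor [i.+1] moves from [Y i.+1] to the exact ones, so passing from
    [hybrid i] only discretizes [Y i]. *)
Lemma hybridS i : (i < n)%N -> hybrid i.+1 =
  TV (indep_prod (discretization g d (Y i))
    (ratio_prod (alg_R P Q) (drop i.+1 (enum 'I_n.+1)))).
Proof.
move=> lt_in; rewrite (drop_nth ord0) ?size_enum_ord //= TV_indep_prodA.
congr (TV (indep_prod (indep_prod _ (alg_R P Q _)) _)).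
by apply: val_inj; rewrite /= inordK // nth_enum_ord.
Qed.

Lemma hybrid_last : DisProdTV P Q eps =
  TV (indep_prod (discretization g d (Y n))
    (ratio_prod (alg_R P Q) (drop n.+1 (enum 'I_n.+1)))).
Proof. by rewrite drop_oversize ?size_enum_ord //= TV_indep_prod_one. Qed.

Lemma hybrid_le i : (i <= n)%N -> hybrid i <= D.
Proof.
elim: i => [|i IH] lt_in; first by rewrite hybrid0.
rewrite hybridS //; apply: le_trans (discretization_TV_le _ _ _ _) _.
exact/IH/ltnW.
Qed.

Lemma DisProdTV_le : DisProdTV P Q eps <= D.
Proof.
rewrite hybrid_last; apply: le_trans (discretization_TV_le _ _ _ _) _.
exact: hybrid_le.
Qed.

Lemma dTV_prodn_ge0 : 0 <= D.
Proof. by rewrite /D -TV_ratio TV_ge0. Qed.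

Lemma alg_Delta_ge0 : 0 <= alg_Delta P Q.
Proof.
apply: le_trans (le_bigmax 0 (fun i => dTV (P i) (Q i)) ord0).
by rewrite -TV_ratio TV_ge0.
Qed.

Lemma alg_Delta_le : alg_Delta P Q <= D.
Proof.
apply: bigmax_le => [|i _]; first exact: dTV_prodn_ge0.
rewrite /D -TV_ratio_prod -TV_ratio.
by apply: (TV_le_ratio_prod (fun i => Defs.ratio (P i) (Q i))); rewrite mem_enum.
Qed.

(** The loss is [g + d * TV (Y i)], and [TV (Y i) <= hybrid i <= D]: extra factors cannot lower the
    total variation, earlier discretizations cannot raise it. *)
Lemma hybrid_step i : 0 < g -> g < 1 -> 0 < d -> (i <= n)%N ->
  hybrid i <= TV (indep_prod (discretization g d (Y i))
    (ratio_prod (alg_R P Q) (drop i.+1 (enum 'I_n.+1)))) + (g + d * D).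
Proof.
move=> g0 g1 d0 le_in; apply: le_trans (discretization_TV_ge _ _ _ _ g0 g1 d0) _.
rewrite lerD2l lerD2l ler_pM2l //.
exact: le_trans (TV_le_indep_prod _ _) (hybrid_le i le_in).
Qed.

Lemma hybrid_ge i : 0 < g -> g < 1 -> 0 < d -> (i <= n)%N ->
  D <= hybrid i + i%:R * (g + d * D).
Proof.
move=> g0 g1 d0; elim: i => [|i IH] lt_in; first by rewrite mul0r addr0 hybrid0.
apply: le_trans (IH (ltnW lt_in)) _.
have := hybrid_step i g0 g1 d0 (ltnW lt_in); rewrite -hybridS // -natr1.
by move: (g + d * D) => e; lra.
Qed.

Lemma dTV_prodn_eq0 : alg_Delta P Q = 0 -> D = 0.
Proof.
move=> Delta0; suff PQ i x : P i x = Q i x.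
  rewrite /D -TV_ratio; apply: big1 => x _ /=.
  have -> : \prod_i P i (x i) = \prod_i Q i (x i) by apply: eq_bigr => i _.
  have [->|q0] := eqVneq (\prod_i Q i (x i)) 0; first by rewrite mul0r.
  by rewrite mulfV // subrr maxxx mulr0.
have d0 : dTV (P i) (Q i) <= 0.
  by rewrite -Delta0; exact: (le_bigmax 0 (fun i => dTV (P i) (Q i))).
have bnd : `|Pr (P i) [set x] - Pr (Q i) [set x]| <= 0.
  apply: le_trans d0; apply: ub_le_sup; last by exists [set x]%SET.
  exists 2 => _ [A _ <-].
  have Pr01 (T : finType) (p : fdist R T) B : 0 <= Pr p B <= 1.
    rewrite /Pr sumr_ge0 => [|z _]; last exact: pmf_ge0.
    rewrite -(pmf_sum1 p) big_mkcond /=; apply: ler_sum => z _.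
    by case: ifP => // _; exact: pmf_ge0.
  have := Pr01 _ (P i) A; have := Pr01 _ (Q i) A; rewrite ler_norml; lra.
by move: bnd; rewrite normr_le0 /Pr !big_set1 subr_eq0 => /eqP.
Qed.

Lemma DisProdTV_ge : 0 < eps -> eps < 1 -> (1 - eps) * D <= DisProdTV P Q eps.
Proof.
move=> eps0 eps1; have := alg_Delta_ge0; rewrite le_eqVlt => /orP[/eqP/esym|] Delta.
  by rewrite dTV_prodn_eq0 // mulr0 TV_ge0.
have N0 : 0 < n.+1%:R :> R by rewrite ltr0n.
have N1 : 1 <= n.+1%:R :> R by rewrite ler1n.
have Delta_le := alg_Delta_le.
have D1 : D <= 1 by exact: dTV_le1.
have g0 : 0 < g by rewrite divr_gt0 ?mulr_gt0.
have d0 : 0 < d by rewrite divr_gt0 ?mulr_gt0.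
have g1 : g < 1 by rewrite ltr_pdivrMr ?mulr_gt0 //; nra.
(* The halves in [g] and [d] pay for one term each, using [alg_Delta P Q <= D]. *)
have budget : n.+1%:R * (g + d * D) <= eps * D.
  have -> : n.+1%:R * (g + d * D) = eps / 2 * (alg_Delta P Q + D).
    rewrite /g /d /alg_gamma /alg_delta.
    move: (alg_Delta P Q) (D) (n.+1%:R : R) N0 => u v N N0; field.
    by rewrite gt_eqF.
  by nra.
(* The first bound covers [n] of the losses, the second the final discretization. *)
have := hybrid_ge n g0 g1 d0 (leqnn n); have := hybrid_step n g0 g1 d0 (leqnn n).
rewrite -hybrid_last; move: budget; rewrite -natr1.
by move: (g + d * D) => e; lra.
Qed.

End Correctness.

Theorem theorem6 (R : realType) (n M : nat) (P Q : 'I_n.+1 -> fdist R 'I_M)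
    (eps : rat) (heps0 : 0 < eps) (heps1 : eps < 1) :
  (1 - ratr eps) * dTV (prodn P) (prodn Q) <= DisProdTV P Q (ratr eps) /\
  DisProdTV P Q (ratr eps) <= (1 + ratr eps) * dTV (prodn P) (prodn Q).
Proof.
have e0 : 0 < ratr eps :> R by rewrite ltr0q.
have e1 : ratr eps < 1 :> R by rewrite -(rmorph1 (@ratr R)) ltr_rat.
split; first exact: DisProdTV_ge.
apply: le_trans (DisProdTV_le P Q (ratr eps)) _.
by rewrite ler_peMl ?dTV_prodn_ge0 // lerDl ltW.
Qed.
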